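(* Let $A\in\mathbb{R}^{n\times n}$ be symmetric positive definite, partitioned in $p\times p$ block form $A=(A_{ij})_{i,j=1}^p$ with square diagonal blocks, and let $\bm{b}\in\mathbb{R}^n$. Write $A=D_{\mathrm b}+L_{\mathrm b}+U_{\mathrm b}$ with $D_{\mathrm b}=\mathrm{diag}(A_{11},\dots,A_{pp})$ block diagonal, and $L_{\mathrm b}$, $U_{\mathrm b}$ strictly lower and strictly upper block triangular, respectively. Let $h>0$ be the stepsize of the block Itoh--Abe discrete gradient scheme with $P=D_{\mathrm b}^{-1}$ for $f(\bm{x})=\frac12\bm{x}^\top A\bm{x}-\bm{x}^\top\bm{b}$, and let $\omega\in(0,2)$ be the relaxation parameter of the block SOR method for $A\bm{x}=\bm{b}$. If $$h=\frac{2\omega}{2-\omega},$$ then the scheme and the block SOR method are equivalent in the sense that $G_{\mathrm{BDG}}=G_{\mathrm{BSOR}}$ and $\bm{c}_{\mathrm{BDG}}=\bm{c}_{\mathrm{BSOR}}$, where $\bm{x}^{(k+1)}=G_{\mathrm{BDG}}\bm{x}^{(k)}+\bm{c}_{\mathrm{BDG}}$ and $\bm{x}^{(k+1)}=G_{\mathrm{BSOR}}\bm{x}^{(k)}+\bm{c}_{\mathrm{BSOR}}$ are the matrix forms of the two methods.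
   Context: Vectors are partitioned conformally with $A$: $\bm{x}=(\bm{x}_1^\top,\dots,\bm{x}_p^\top)^\top$, and likewise $\bm{b}$. The block Itoh--Abe discrete gradient of a continuously differentiable $f$ has $i$th block $$(\nabla_{\mathrm d} f(\bm{x},\bm{y}))_i=\int_0^1\nabla_i f(\bm{x}_1,\dots,\bm{x}_{i-1},\xi\bm{x}_i+(1-\xi)\bm{y}_i,\bm{y}_{i+1},\dots,\bm{y}_p)\,\mathrm{d}\xi,$$ where $\nabla_i$ is the gradient with respect to the $i$th block; for $f(\bm{x})=\frac12\bm{x}^\top A\bm{x}-\bm{x}^\top\bm{b}$ it equals $\sum_{j<i}A_{ij}\bm{x}_j+A_{ii}\frac{\bm{x}_i+\bm{y}_i}{2}+\sum_{j>i}A_{ij}\bm{y}_j-\bm{b}_i$. The discrete gradient scheme with stepsize $h>0$ and matrix $P$ is $\frac{\bm{x}^{(k+1)}-\bm{x}^{(k)}}{h}=-P\,\nabla_{\mathrm d} f(\bm{x}^{(k+1)},\bm{x}^{(k)})$, $k=0,1,2,\dots$. For $P=D_{\mathrm b}^{-1}$ it reads, for $i=1,\dots,p$, $$\bm{x}_i^{(k+1)}=\frac{1}{1+\frac h2}\Big[-hA_{ii}^{-1}\sum_{j<i}A_{ij}\bm{x}_j^{(k+1)}+\Big(1-\frac h2\Big)\bm{x}_i^{(k)}-hA_{ii}^{-1}\sum_{j>i}A_{ij}\bm{x}_j^{(k)}+hA_{ii}^{-1}\bm{b}_i\Big],$$ and its matrix form $\bm{x}^{(k+1)}=G_{\mathrm{BDG}}\bm{x}^{(k)}+\bm{c}_{\mathrm{BDG}}$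 has $$G_{\mathrm{BDG}}=\Big[\Big(1+\frac h2\Big)D_{\mathrm b}+hL_{\mathrm b}\Big]^{-1}\Big[\Big(1-\frac h2\Big)D_{\mathrm b}-hU_{\mathrm b}\Big],\qquad \bm{c}_{\mathrm{BDG}}=h\Big[\Big(1+\frac h2\Big)D_{\mathrm b}+hL_{\mathrm b}\Big]^{-1}\bm{b}.$$ The block SOR method with relaxation parameter $\omega$ is $\bm{x}^{(k+1)}=G_{\mathrm{BSOR}}\bm{x}^{(k)}+\bm{c}_{\mathrm{BSOR}}$ with $$G_{\mathrm{BSOR}}=(D_{\mathrm b}+\omega L_{\mathrm b})^{-1}[(1-\omega)D_{\mathrm b}-\omega U_{\mathrm b}],\qquad \bm{c}_{\mathrm{BSOR}}=\omega(D_{\mathrm b}+\omega L_{\mathrm b})^{-1}\bm{b}.$$ *)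

(* Defs.v *)
From HB Require Import structures.
From mathcomp Require Export all_boot all_order all_algebra.
From mathcomp Require Export all_classical all_reals all_analysis.
Set Implicit Arguments.
Unset Strict Implicit.
Unset Printing Implicit Defensive.
Import Order.TTheory GRing.Theory Num.Theory.
Import numFieldNormedType.Exports.
Local Open Scope ring_scope.
Local Open Scope classical_set_scope.

Definition sym_posdef (R : realType) (n : nat) (A : 'M[R]_n) : Prop :=
  A^T = A /\ forall x : 'cV[R]_n, x != 0 -> 0 < (x^T *m A *m x) 0 0.

(* A p x p block partition of R^n with square diagonal blocks is given by the
   block sizes q : 'I_p -> nat, with n = \sum_i q i; block (i, j) of A is
   submxblock A i j : 'M_(q i, q j) and block i of x is
   submxcol x i : 'cV_(q i). *)

Definition blkdiag (R : realType) (p : nat) (q : 'I_p -> nat)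
    (A : 'M[R]_(\sum_(i < p) q i)) : 'M[R]_(\sum_(i < p) q i) :=
  \mxdiag_(i < p) submxblock A i i.

Definition blklow (R : realType) (p : nat) (q : 'I_p -> nat)
    (A : 'M[R]_(\sum_(i < p) q i)) : 'M[R]_(\sum_(i < p) q i) :=
  \mxblock_(i < p, j < p)
    (if (j < i)%N then submxblock A i j else 0 : 'M[R]_(q i, q j)).

Definition blkup (R : realType) (p : nat) (q : 'I_p -> nat)
    (A : 'M[R]_(\sum_(i < p) q i)) : 'M[R]_(\sum_(i < p) q i) :=
  \mxblock_(i < p, j < p)
    (if (i < j)%N then submxblock A i j else 0 : 'M[R]_(q i, q j)).

Lemma blk_splitting (R : realType) (p : nat) (q : 'I_p -> nat)
    (A : 'M[R]_(\sum_(i < p) q i)) :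
  A = blkdiag A + blklow A + blkup A.
Proof.
rewrite -[LHS]submxblockK /blkdiag /mxdiag -!mxblockD.
apply: eq_mxblock => i j; case: eqVneq => [<-|ij].
  by rewrite conform_mx_id ltnn !addr0.
rewrite add0r; case: ltngtP => [_|_|/val_inj eij]; rewrite ?addr0 ?add0r //.
by rewrite eij eqxx in ij.
Qed.

Definition quad_fun (R : realType) (n : nat) (A : 'M[R]_n) (b : 'cV[R]_n)
    (x : 'cV[R]_n) : R :=
  2^-1 * (x^T *m A *m x) 0 0 - (x^T *m b) 0 0.

(* tagnat.Rank i k is the position, in the whole vector, of entry k of
   block i. *)
Definition blkgrad (R : realType) (p : nat) (q : 'I_p -> nat)
    (f : 'cV[R]_(\sum_(i < p) q i) -> R) (i : 'I_p)
    (x : 'cV[R]_(\sum_(i < p) q i)) : 'cV[R]_(q i) :=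
  \col_(k < q i) ('D_(delta_mx (tagnat.Rank i k) 0) f x : R).

Definition itoh_abe_point (R : realType) (p : nat) (q : 'I_p -> nat)
    (x y : 'cV[R]_(\sum_(i < p) q i)) (i : 'I_p) (xi : R) :
    'cV[R]_(\sum_(i < p) q i) :=
  \mxcol_(j < p)
    (if (j < i)%N then submxcol x j
     else if j == i then xi *: submxcol x j + (1 - xi) *: submxcol y j
     else submxcol y j).

Definition itoh_abe_dgrad (R : realType) (p : nat) (q : 'I_p -> nat)
    (f : 'cV[R]_(\sum_(i < p) q i) -> R)
    (x y : 'cV[R]_(\sum_(i < p) q i)) : 'cV[R]_(\sum_(i < p) q i) :=
  \mxcol_(i < p) \col_(k < q i)
    \int[lebesgue_measure]_(xi in `[0%R, 1%R])
      blkgrad f i (itoh_abe_point x y i xi) k 0.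

Definition dgrad_scheme (R : realType) (p : nat) (q : 'I_p -> nat)
    (f : 'cV[R]_(\sum_(i < p) q i) -> R) (h : R)
    (P : 'M[R]_(\sum_(i < p) q i))
    (x : nat -> 'cV[R]_(\sum_(i < p) q i)) : Prop :=
  forall k : nat,
    h^-1 *: (x k.+1 - x k) = - (P *m itoh_abe_dgrad f (x k.+1) (x k)).

Definition G_BDG (R : realType) (p : nat) (q : 'I_p -> nat)
    (A : 'M[R]_(\sum_(i < p) q i)) (h : R) : 'M[R]_(\sum_(i < p) q i) :=
  invmx ((1 + h / 2) *: blkdiag A + h *: blklow A)
    *m ((1 - h / 2) *: blkdiag A - h *: blkup A).

Definition c_BDG (R : realType) (p : nat) (q : 'I_p -> nat)
    (A : 'M[R]_(\sum_(i < p) q i)) (b : 'cV[R]_(\sum_(i < p) q i)) (h : R) :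
    'cV[R]_(\sum_(i < p) q i) :=
  h *: (invmx ((1 + h / 2) *: blkdiag A + h *: blklow A) *m b).

Definition G_BSOR (R : realType) (p : nat) (q : 'I_p -> nat)
    (A : 'M[R]_(\sum_(i < p) q i)) (omega : R) : 'M[R]_(\sum_(i < p) q i) :=
  invmx (blkdiag A + omega *: blklow A)
    *m ((1 - omega) *: blkdiag A - omega *: blkup A).

Definition c_BSOR (R : realType) (p : nat) (q : 'I_p -> nat)
    (A : 'M[R]_(\sum_(i < p) q i)) (b : 'cV[R]_(\sum_(i < p) q i))
    (omega : R) : 'cV[R]_(\sum_(i < p) q i) :=
  omega *: (invmx (blkdiag A + omega *: blklow A) *m b).

(* Main.v *)
(* The restriction of the gradient Ax - b to the segment defining block i is
   affine in the integration variable, so the Itoh-Abe discrete gradient is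
   L x + D (x + y) / 2 + U y - b, and one step of the scheme rearranges to
   M x = N y + h b with M = (1 + h/2) D + h L and N = (1 - h/2) D - h U; M is
   invertible because its symmetric part D + (h/2) A is positive definite.
   For h = 2 omega / (2 - omega) and s = 2 / (2 - omega), one has
   1 + h/2 = s, h = s omega and 1 - h/2 = s (1 - omega), so that M and N are s
   times the matrices of block SOR. *)
Require Import Defs.
From mathcomp Require Import ring.
Set Implicit Arguments.
Unset Strict Implicit.
Unset Printing Implicit Defensive.
Import Order.TTheory GRing.Theory Num.Theory.
Import numFieldNormedType.Exports.
Local Open Scope ring_scope.

Lemma mulmx_tr_sym (R : comNzRingType) (n : nat) (A : 'M[R]_n) (x y : 'cV[R]_n) :
  (x^T *m A *m y) 0 0 = (y^T *m A^T *m x) 0 0.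
Proof.
transitivity ((x^T *m A *m y)^T 0 0); first by rewrite [RHS]mxE.
by rewrite !trmx_mul trmxK mulmxA.
Qed.

(** A row [v] with [v A = 0] would make the form vanish at [v^T]. Symmetry is not assumed, so this
    also covers the nonsymmetric matrix of the scheme. *)
Lemma posdef_unitmx (R : realType) (n : nat) (A : 'M[R]_n) :
  (forall x : 'cV[R]_n, x != 0 -> 0 < (x^T *m A *m x) 0 0) -> A \in unitmx.
Proof.
move=> Apos; rewrite unitmxE unitfE; apply/det0P => -[v v0 vA].
have := Apos v^T; rewrite trmxK vA mul0mx mxE ltxx => H.
suff : v^T != 0 by move/H.
by apply: contraNneq v0 => vT0; rewrite -[v]trmxK vT0 trmx0.
Qed.

(** For [t] nonzero the difference quotient is [a + t * c]. The gradient of a quadratic can thus be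
    read off its expansion along a line. *)
Lemma derive_parabola (R : realType) (V : normedModType R) (f : V -> R)
    (x v : V) (a c : R) :
  (forall t : R, f (t *: v + x) - f x = t * a + t ^+ 2 * c) ->
  'D_v f x = a.
Proof.
move=> fE; apply/cvg_lim => //=.
have lim0 : ((a + t * c) @[t --> (0 : R)^'] --> a)%classic.
  rewrite [X in (_ --> X)%classic](_ : a = a + 0 * c); last by rewrite mul0r addr0.
  apply: cvgD; first exact: cvg_cst.
  apply: cvgM; last exact: cvg_cst.
  exact: cvg_within_filter.
apply: cvg_trans lim0; apply: near_eq_cvg; near=> t.
rewrite /= fE /GRing.scale /=; field.
near: t; exact: nbhs_dnbhs_neq.
Unshelve. all: by end_near.
Qed.

Lemma Rintegral01_affine (R : realType) (a c : R) :
  \int[lebesgue_measure]_(t in `[0%R, 1%R]) (t * a + c) = a / 2 + c.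
Proof.
pose F (t : R) : R := t ^+ 2 * (a / 2) + t * c.
have dF (t : R) : is_derive t 1 F (t * a + c).
  rewrite /F; apply: is_derive_eq.
  by rewrite /GRing.scale /=; field.
have cF : continuous F.
  move=> t; apply: differentiable_continuous.
  by apply/derivable1_diffP; exact: ex_derive.
rewrite /Rintegral (@continuous_FTC2 _ _ F) //.
- by rewrite /F /=; field.
- apply: continuous_subspaceT => t.
  by apply: cvgD; [apply: cvgM => //; exact: cvg_cst|exact: cvg_cst].
- split.
  + by move=> t _; exact: ex_derive.
  + by apply: cvg_at_right_filter; exact: cF.
  + by apply: cvg_at_left_filter; exact: cF.
- by move=> t _; rewrite derive1E derive_val.
Qed.

Section Blocks.
Variables (R : realType) (p : nat) (q : 'I_p -> nat).
Implicit Types (A : 'M[R]_(\sum_(i < p) q i)) (b u v x y : 'cV[R]_(\sum_(i < p) q i)).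

(** [tagnat.sig1 a] is the block containing position [a], so block identities reduce to entrywise
    comparisons of block indices. *)
Lemma blkdiagE A a c :
  blkdiag A a c = if tagnat.sig1 a == tagnat.sig1 c then A a c else 0.
Proof.
have -> : blkdiag A = \mxblock_(i, j) if i == j then submxblock A i j else 0.
  by apply: eq_mxblock => i j; case: eqVneq => // <-; rewrite conform_mx_id.
by rewrite mxE; case: eqP => _; rewrite !mxE // !tagnat.sig2K.
Qed.

Lemma blklowE A a c :
  blklow A a c = if (tagnat.sig1 c < tagnat.sig1 a)%N then A a c else 0.
Proof. by rewrite mxE; case: ifP => _; rewrite !mxE // !tagnat.sig2K. Qed.

Lemma blkupE A a c :
  blkup A a c = if (tagnat.sig1 a < tagnat.sig1 c)%N then A a c else 0.
Proof. by rewrite mxE; case: ifP => _; rewrite !mxE // !tagnat.sig2K. Qed.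

Lemma tr_blklow A : (blklow A)^T = blkup A^T.
Proof. by apply/matrixP => a c; rewrite mxE blklowE blkupE mxE. Qed.

Lemma blkdiag_posdef A : sym_posdef A ->
  forall x, x != 0 -> 0 < (x^T *m blkdiag A *m x) 0 0.
Proof.
move=> [_ Apos] x x0.
(* E i projects onto block i, so that x^T D x is the sum of the
   (E i x)^T A (E i x). *)
pose E i : 'M[R]_(\sum_(i < p) q i) :=
  diag_mx (\row_c (tagnat.sig1 c == i)%:R).
have -> : blkdiag A = \sum_i E i *m A *m E i.
  apply/matrixP => a c; rewrite blkdiagE summxE.
  rewrite [RHS](bigD1 (tagnat.sig1 a)) //= [X in _ + X]big1 ?addr0 => [|i ia];
    rewrite mul_mx_diag mxE mul_diag_mx !mxE.
    by rewrite eqxx mul1r eq_sym; case: eqP; rewrite ?mulr1 ?mulr0.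
  by rewrite eq_sym (negbTE ia) !mul0r.
have Ege0 (y : 'cV[R]_(\sum_(i < p) q i)) : 0 <= (y^T *m A *m y) 0 0.
  by case: (eqVneq y 0) => [->|/Apos/ltW//]; rewrite mulmx0 mxE.
have -> : (x^T *m (\sum_i E i *m A *m E i) *m x) 0 0 =
    \sum_i ((E i *m x)^T *m A *m (E i *m x)) 0 0.
  rewrite mulmx_sumr mulmx_suml summxE; apply: eq_bigr => i _.
  by rewrite trmx_mul tr_diag_mx !mulmxA.
have [c xc0] : exists c, x c 0 != 0.
  apply/existsP; apply: contraNT x0; rewrite negb_exists => /forallP x0.
  by apply/eqP/colP => c; rewrite mxE; apply/eqP; rewrite -[_ == _]negbK.
(* The block containing a nonzero entry of [x] contributes a positive term; the other terms are
   nonnegative. *)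
rewrite (bigD1 (tagnat.sig1 c)) //= ltr_wpDr ?sumr_ge0 // Apos //.
apply: contraNneq xc0 => /colP/(_ c).
by rewrite mul_diag_mx !mxE eqxx mul1r => ->.
Qed.

(* The form of D + (h/2) (D + 2L) equals that of D + (h/2) A, as U = L^T. *)
Lemma bdg_unitmx A (h : R) : sym_posdef A -> 0 < h ->
  (1 + h / 2) *: blkdiag A + h *: blklow A \in unitmx.
Proof.
move=> spA h0; apply: posdef_unitmx => x x0.
have D0 := blkdiag_posdef spA x0; have [At Apos] := spA.
have := Apos _ x0; rewrite [in X in X -> _](blk_splitting A).
pose Q M := (x^T *m M *m x) 0 0.
have QD M N : Q (M + N) = Q M + Q N by rewrite /Q mulmxDr mulmxDl mxE.
have QZ k M : Q (k *: M) = k * Q M by rewrite /Q -scalemxAr -scalemxAl mxE.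
have QU : Q (blkup A) = Q (blklow A) by rewrite [RHS]/Q mulmx_tr_sym tr_blklow At.
rewrite -!/(Q _) !QD !QZ QU.
move: D0; rewrite -/(Q _); move: (Q (blkdiag A)) (Q (blklow A)) => d l d0 dl0.
have -> : (1 + h / 2) * d + h * l = d + h / 2 * (d + l + l) by field.
by rewrite addr_gt0 // mulr_gt0 // divr_gt0.
Qed.

Lemma blkgrad_quad_fun A b i x (k : 'I_(q i)) : A^T = A ->
  blkgrad (quad_fun A b) i x k 0 = (A *m x - b) (tagnat.Rank i k) 0.
Proof.
move=> At; rewrite mxE; set v := delta_mx _ _.
have vE (y : 'cV[R]_(\sum_(i < p) q i)) :
    y (tagnat.Rank i k) 0 = (v^T *m y) 0 0.
  by rewrite /v trmx_delta -rowE mxE.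
(* The given constant is the coefficient of [t ^+ 2]; symmetry of [A] merges the two cross terms
   into the linear one. *)
rewrite vE; apply: derive_parabola
  (2^-1 * (v^T *m A *m v) 0 0) _ => t.
have xv := mulmx_tr_sym A x v; rewrite At in xv.
rewrite /quad_fun [(_ + _)^T]linearP /= !(mulmxDl, mulmxDr) -!(scalemxAl, scalemxAr).
rewrite mulmxN !mulmxA.
have mxD (M N : 'M[R]_1) : (M + N) 0 0 = M 0 0 + N 0 0 by rewrite mxE.
have mxN (M : 'M[R]_1) : (- M) 0 0 = - M 0 0 by rewrite mxE.
have mxZ r (M : 'M[R]_1) : (r *: M) 0 0 = r * M 0 0 by rewrite mxE.
rewrite !(mxD, mxZ, mxN) xv.
by field.
Qed.

Lemma itoh_abe_dgrad_quad A b x y : A^T = A ->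
  itoh_abe_dgrad (quad_fun A b) x y =
  blklow A *m x + blkdiag A *m (2^-1 *: (x + y)) + blkup A *m y - b.
Proof.
move=> At; apply/colP => a; rewrite mxE mxE.
(* [s] is the slope of the integrand and [r] its value at 0, where the current block is that of [y].
   The mean [s / 2 + r] turns [D y] into [D (x + y) / 2]. *)
pose s := (blkdiag A *m (x - y)) a 0.
pose r := (blklow A *m x + blkdiag A *m y + blkup A *m y - b) a 0.
transitivity (\int[lebesgue_measure]_(t in `[0%R, 1%R]) (t * s + r)).
  apply: eq_Rintegral => t _.
  rewrite blkgrad_quad_fun // tagnat.sig2K /s /r !mxE.
  rewrite addrA; congr (_ - _); rewrite mulr_sumr -!big_split /=.
  apply: eq_bigr => c _; rewrite blklowE blkdiagE blkupE !mxE.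
  rewrite [tagnat.sig1 c == _]eq_sym -val_eqE /=.
  by case: ltngtP => _; rewrite ?mxE ?tagnat.sig2K; move: (t : R) => {}t; ring.
rewrite Rintegral01_affine /s /r.
rewrite scalerDr !mulmxDr mulmxN -!scalemxAr !mxE.
by field.
Qed.

Lemma dgrad_step_bdg A b u v (h : R) : sym_posdef A -> 0 < h ->
  h^-1 *: (u - v) =
    - (invmx (blkdiag A) *m itoh_abe_dgrad (quad_fun A b) u v) <->
  u = G_BDG A h *m v + c_BDG A b h.
Proof.
move=> spA h0; have UM := bdg_unitmx spA h0.
have UD := posdef_unitmx (blkdiag_posdef spA).
have hN0 : h != 0 by rewrite gt_eqF.
rewrite itoh_abe_dgrad_quad ?spA.1 // /G_BDG /c_BDG.
set g := _ - b; set M := _ + h *: blklow A; set N := (1 - h / 2) *: _ - _.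
(* The left side vanishes exactly for a step of the iteration, the right side exactly for a step of
   the scheme multiplied by [h D]. *)
have residual : M *m u - (N *m v + h *: b) = blkdiag A *m (u - v) + h *: g.
  rewrite /M /N /g -[blkdiag A *m (_ *: _)]scalemxAr.
  rewrite !(mulmxDl, mulmxDr, mulmxN, mulNmx) -!(scalemxAl, scalemxAr).
  by apply/colP => a; rewrite !mxE; field.
split=> [step|step].
- have Duv : blkdiag A *m (u - v) = - (h *: g).
    rewrite -[u - v](scalerKV hN0) step scalerN mulmxN -scalemxAr mulmxA.
    by rewrite mulmxV // mul1mx.
  move: residual; rewrite Duv addNr => /subr0_eq MuE.
  by rewrite -mulmxA scalemxAr -mulmxDr -MuE mulKmx.
- have MuE : M *m u = N *m v + h *: b.
    by rewrite step -mulmxA scalemxAr -mulmxDr mulKVmx.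
  move: residual; rewrite MuE subrr => /esym/eqP; rewrite addr_eq0 => /eqP Duv.
  rewrite -[u - v](mulKmx UD) Duv mulmxN -scalemxAr scalerN scalerA.
  by rewrite mulVf // scale1r.
Qed.

End Blocks.

Theorem proposition4 (R : realType) (p : nat) (q : 'I_p -> nat)
    (A : 'M[R]_(\sum_(i < p) q i)) (b : 'cV[R]_(\sum_(i < p) q i))
    (h omega : R) :
  sym_posdef A -> 0 < h -> 0 < omega -> omega < 2 ->
  h = 2 * omega / (2 - omega) ->
  [/\ forall x : nat -> 'cV[R]_(\sum_(i < p) q i),
        dgrad_scheme (quad_fun A b) h (invmx (blkdiag A)) x <->
        (forall k : nat, x k.+1 = G_BDG A h *m x k + c_BDG A b h),
      G_BDG A h = G_BSOR A omega
    & c_BDG A b h = c_BSOR A b omega].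
Proof.
move=> spA h0 w0 w2 hE; have UM := bdg_unitmx spA h0.
have w2N0 : 2 - omega != 0 by rewrite subr_eq0 gt_eqF.
pose s := 2 / (2 - omega).
have sN0 : s != 0 by rewrite mulf_neq0 ?invr_eq0.
have hs : h = s * omega by rewrite hE /s; field.
have h1s : 1 + h / 2 = s by rewrite hE /s; field.
have h2s : 1 - h / 2 = s * (1 - omega) by rewrite hE /s; field.
clearbody s.
have ME : (1 + h / 2) *: blkdiag A + h *: blklow A =
    s *: (blkdiag A + omega *: blklow A).
  by rewrite h1s scalerDr scalerA hs.
(* Invertibility in this scaled form lets [invmxZ] pull out [s^-1], which cancels the factor [s] of
   [N] and of [h *: b]. *)
rewrite ME in UM; split.
- by move=> x; split=> H k; apply/(dgrad_step_bdg b _ _ spA h0).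
- rewrite /G_BDG /G_BSOR ME invmxZ // h2s hs -!scalerA -scalerBr.
  by rewrite -scalemxAl -scalemxAr scalerA mulVf // scale1r.
- rewrite /c_BDG /c_BSOR ME invmxZ // -scalemxAl scalerA hs.
  by rewrite mulrAC mulfV // mul1r.
Qed.
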